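(* Let $\varepsilon\in[0,1)$ be a constant. For even $n$, choose $A\in\mathbb{Z}_2^{(n/2)\times n}$ by setting each entry to $0$ or $1$ uniformly and independently, and let $S=\{x\in\{0,1\}^n: Ax\equiv 0\pmod 2\}$. Let $\widehat{f}_S:\{0,1\}^n\to\mathbb{R}$ be given by $\widehat f_S(x)=1/\sqrt{|S|}$ if $x\in S$ and $\widehat f_S(x)=0$ otherwise. Then $\mathrm{MFS}_\varepsilon(\widehat{f}_S)=n^{\Omega(\log n)}$ with probability $\Omega(1)$ over $S$. That is, there are constants $c,c'>0$ such that for all sufficiently large even $n$, $\Pr_S\left[\mathrm{MFS}_\varepsilon(\widehat f_S)\ge n^{c\log n}\right]\ge c'$.
   Context: An arithmetic formula over $\mathbb{C}$ in variables $x_1,\dots,x_n$ is a rooted binary tree whose leaves are labeled with complex numbers or variables and whose non-leaf vertices are labeled $+$ or $\times$; it computes a polynomial in the obvious way. A polynomial is multilinear if no variable appears raised to a power higher than $1$; a formula is multilinear if the polynomial computed by each of its subtrees is multilinear. The size of a formula is its number of leaves. For a multilinear polynomial $p$, $\mathrm{MFS}(p)$ is the minimum size of a multilinear formula computing $p$. For $f:\{0,1\}^n\to\mathbb{C}$, the $\varepsilon$-approximate multilinear formula size $\mathrm{MFS}_\varepsilon(f)$ is the minimum of $\mathrm{MFS}(p)$ over multilinear polynomials $p$ with $\sum_{x\in\{0,1\}^n}|p(x)-f(x)|^2\le\varepsilon$. *)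

(* Defs.v *)
(* The complex field is R[i] for R : realType. *)
From HB Require Import structures.
From mathcomp Require Import all_boot all_order all_algebra.
From mathcomp Require Import boolp classical_sets reals exp.
From mathcomp Require Import complex.
(* The notations of mpoly do not parse together with those of the analysis
   library; only its constants, coercions and instances are imported. *)
From mathcomp Require Import -(notations) mpoly.

Set Implicit Arguments.
Unset Strict Implicit.
Unset Printing Implicit Defensive.

Import Order.TTheory GRing.Theory Num.Theory.
Local Open Scope ring_scope.
Local Open Scope complex_scope.

Section Minimum.
Local Open Scope classical_set_scope.

Definition is_min_nat (P : set nat) (m : nat) : Prop :=
  P m /\ forall k, P k -> (m <= k)%N.

(* Least element of P; the value 0 is used only when P is empty. *)
Definition min_nat (P : set nat) : nat := xget 0%N (is_min_nat P).

Lemma min_natP (P : set nat) : P !=set0 -> is_min_nat P (min_nat P).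
Proof.
move=> [k Pk]; apply: (@xgetPex _ 0%N (is_min_nat P)).
have exP : exists k, `[< P k >] by exists k; apply/asboolP.
exists (ex_minn exP); case: ex_minnP => m /asboolP Pm m_min.
by split=> // j Pj; apply/m_min/asboolP.
Qed.

End Minimum.

Inductive formula (K : Type) (n : nat) : Type :=
  | FConst of K
  | FVar of 'I_n
  | FAdd of formula K n & formula K n
  | FMul of formula K n & formula K n.

Fixpoint formula_size (K : Type) (n : nat) (F : formula K n) : nat :=
  match F with
  | FConst _ | FVar _ => 1
  | FAdd F1 F2 | FMul F1 F2 => formula_size F1 + formula_size F2
  end.

Fixpoint formula_poly (K : nzRingType) (n : nat) (F : formula K n) :
    mpoly n K :=
  match F with
  | FConst c => mpolyC n c
  | FVar i => mpolyX K (mnm1 i)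
  | FAdd F1 F2 => formula_poly F1 + formula_poly F2
  | FMul F1 F2 => formula_poly F1 * formula_poly F2
  end.

Definition multilinear (K : nzRingType) (n : nat) (p : mpoly n K) : bool :=
  all (fun m : multinom n => [forall i, (m i <= 1)%N]) (msupp p).

Fixpoint multilinear_formula (K : nzRingType) (n : nat) (F : formula K n) :
    bool :=
  multilinear (formula_poly F) &&
  match F with
  | FConst _ | FVar _ => true
  | FAdd F1 F2 | FMul F1 F2 => multilinear_formula F1 && multilinear_formula F2
  end.

Definition MFS (K : nzRingType) (n : nat) (p : mpoly n K) : nat :=
  min_nat (fun s => exists F : formula K n,
    [/\ multilinear_formula F, formula_poly F = p & formula_size F = s]).

Definition cube (n : nat) := {ffun 'I_n -> bool}.

Definition cube_eval (K : comNzRingType) (n : nat) (p : mpoly n K)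
    (x : cube n) : K :=
  meval (fun i => (x i)%:R) p.

(* The order on R[i] compares complex numbers with equal imaginary parts, so
   the condition below is the real inequality: both sides are real. *)
Definition approximates (R : realType) (n : nat) (eps : R)
    (f : cube n -> R[i]) (p : mpoly n R[i]) : Prop :=
  \sum_(x : cube n) `|cube_eval p x - f x| ^+ 2 <= eps%:C.

Definition MFS_approx (R : realType) (n : nat) (eps : R)
    (f : cube n -> R[i]) : nat :=
  min_nat (fun s => exists p : mpoly n R[i],
    [/\ multilinear p, approximates eps f p & MFS p = s]).

Definition kernel_set (m n : nat) (A : 'M['F_2]_(m, n)) : {set cube n} :=
  [set x : cube n | A *m (\col_(i < n) (x i)%:R) == 0].

Definition normalized_indicator (R : realType) (n : nat) (S : {set cube n})
    (x : cube n) : R :=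
  if x \in S then 1 / Num.sqrt #|S|%:R else 0.

(* Product law: each of the m * n entries takes each of its two values with
   probability 1/2, independently of the others. *)
Definition random_matrix_prob (R : realType) (m n : nat)
    (E : pred 'M['F_2]_(m, n)) : R :=
  \sum_(A : 'M['F_2]_(m, n) | E A) \prod_(i < m) \prod_(j < n) (1 / 2).

(* Main.v *)
(* Any formula expands, by following at each product node the factor with more
   variables, into a sum of at most as many terms as it has leaves; each term
   factors along many disjoint large blocks of variables, which are the sets of
   variables dropped between successive halvings along a path of the formula.
   For a random set T of variables, a fixed term leaves all its blocks nearly
   evenly divided by T with probability n^(-Omega(log n)). A term with an
   unbalanced block has low rank as a matrix with rows indexed by assignments
   to T and columns by assignments to its complement. On the other hand, if
   #|T| = n/2 and both halves of A are invertible, which has constant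
   probability, the indicator of the kernel of A is a permutation matrix for
   this partition; after normalization it is at squared distance at least
   1 - r / 2^(n/2) from every matrix of rank r. *)
Require Import Defs.
From HB Require Import structures.
From mathcomp Require Import all_boot all_order all_algebra.
From mathcomp Require Import boolp classical_sets reals exp.
From mathcomp Require Import complex.
From mathcomp Require Import -(notations) mpoly.
From mathcomp Require Import sesquilinear spectral all_fingroup zify ring.
(* The names of finset take precedence over those of classical_sets. *)
From mathcomp Require Import fintype finset.

Set Implicit Arguments.
Unset Strict Implicit.
Unset Printing Implicit Defensive.

Import Order.TTheory GRing.Theory Num.Theory.

(** * Balanced sets and disjoint blocks *)

(** The weight [m.*2.+1] is what makes the induction close: after inserting the ratio of consecutive
    central coefficients, the step amounts to (2m+1)(2m+3) <= 4(m+1)^2. *)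
Lemma central_bin_sqr m : 'C(m.*2, m) ^ 2 * m.*2.+1 <= 16 ^ m.
Proof.
elim: m => [|m IH]; first by rewrite bin0.
have step : m.+1 * 'C(m.+1.*2, m.+1) = (m.*2.+1).*2 * 'C(m.*2, m).
  rewrite doubleS -mul_bin_diag /=.
  have -> : 'C(m.*2.+1, m) = 'C(m.*2.+1, m.+1).
    by rewrite -[RHS]bin_sub; [congr 'C(_, _)|]; lia.
  have := mul_bin_diag m.*2.+1 m; rewrite /=; nia.
rewrite -(leq_pmul2l (_ : 0 < m.+1 ^ 2)); last by rewrite expn_gt0.
rewrite mulnA -expnMn step expnMn.
apply: (@leq_trans (16 * m.+1 ^ 2 * ('C(m.*2, m) ^ 2 * m.*2.+1))).
  set c := 'C(_, _) ^ 2; nia.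
by rewrite [16 ^ _]expnS -mulnA [X in _ <= X]mulnCA !leq_mul2l IH orbT.
Qed.

Lemma bin_le_central n k : 'C(n, k) <= 'C(n, n./2).
Proof.
have up j : j < n./2 -> 'C(n, j) <= 'C(n, j.+1).
  move=> lt_j; rewrite -(leq_pmul2l (ltn0Sn j)) mul_bin_left leq_mul2r.
  by apply/orP; right; lia.
have low j : j <= n./2 -> 'C(n, j) <= 'C(n, n./2).
  move=> le_j; rewrite -(subKn le_j).
  elim: (n./2 - j) (leq_subr j n./2) => [|d IH] le_d; first by rewrite subn0.
  apply: leq_trans (IH (ltnW le_d)).
  have -> : n./2 - d = (n./2 - d.+1).+1 by lia.
  by apply: up; lia.
have [/low //|lt_k] := leqP k n./2.
have [le_kn|lt_nk] := leqP k n; last by rewrite bin_small.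
by rewrite -bin_sub //; apply: low; lia.
Qed.

Lemma bin_sqr n k : 'C(n, k) ^ 2 * n.+1 <= 4 ^ n.
Proof.
apply: (@leq_trans ('C(n, n./2) ^ 2 * n.+1)).
  by rewrite leq_mul2r leq_exp2r ?bin_le_central ?orbT.
have := odd_double_half n; set m := n./2; case: (odd n) => <- /=; last first.
  by rewrite add0n; apply: leq_trans (central_bin_sqr m) _; rewrite -mul2n expnM.
(* For an odd row, the central coefficient of the next row is twice the one at hand. *)
rewrite add1n; have := central_bin_sqr m.+1.
have -> : 'C(m.+1.*2, m.+1) = ('C(m.*2.+1, m)).*2.
  rewrite doubleS binS -[RHS]addnn; congr (_ + _).
  by rewrite -bin_sub; [congr 'C(_, _)|]; lia.
have -> : 16 ^ m.+1 = 4 * 4 ^ m.*2.+1.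
  by rewrite -expnS (_ : m.*2.+2 = 2 * m.+1) ?expnM //; lia.
set c := 'C(_, _); move: (4 ^ _) => p; nia.
Qed.

Lemma central_bin_ge n : 2 ^ n <= n.+1 * 'C(n, n./2).
Proof.
have <- : \sum_(i < n.+1) 'C(n, i) = 2 ^ n.
  by rewrite -[2]/(1 + 1) expnDn; apply: eq_bigr => i _; rewrite !exp1n !muln1.
apply: (@leq_trans (\sum_(i < n.+1) 'C(n, n./2))).
  by apply: leq_sum => i _; apply: bin_le_central.
by rewrite sum_nat_const card_ord.
Qed.

(** * Counting the sets that nearly halve every block of a disjoint family *)

Section Balance.
Variable I : finType.
Implicit Types (B T X : {set I}) (Bs : seq {set I}).

Definition balanced w T B :=
  (#|B :&: T| <= #|B :\: T| + w) && (#|B :\: T| <= #|B :&: T| + w).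

Lemma balancedI w T X B : B \subset X -> balanced w (T :&: X) B = balanced w T B.
Proof.
move=> /subsetP sBX; rewrite /balanced.
have -> : B :&: (T :&: X) = B :&: T.
  by apply/setP=> i; rewrite !inE; case: (boolP (i \in B)) => // /sBX ->; rewrite andbT.
have -> // : B :\: (T :&: X) = B :\: T.
by apply/setP=> i; rewrite !inE; case: (boolP (i \in B)) => [/sBX ->|]; rewrite ?andbT ?andbF.
Qed.

(** The sizes of balanced subsets of [B] lie in a window of [w.+1] consecutive values starting at
    [lo], and each size is taken by at most a central binomial coefficient of sets. *)
Lemma card_balanced_bin w B :
  #|[set U : {set I} | (U \subset B) && balanced w U B]| <=
    w.+1 * 'C(#|B|, #|B|./2).
Proof.
set D := [set U | _]; set m := #|B|; pose lo := (m - w).+1./2.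
have D_card U : U \in D -> lo <= #|U| <= lo + w.
  rewrite inE => /andP[sUB]; rewrite /balanced (setIidPr sUB).
  have := cardsID U B; rewrite (setIidPr sUB) -/m /lo; lia.
pose f (U : {set I}) : 'I_w.+1 := inord (#|U| - lo).
rewrite -[#|D|]sum1_card (partition_big f predT) //=.
apply: (@leq_trans (\sum_(j < w.+1) 'C(m, m./2))); last first.
  by rewrite sum_nat_const card_ord.
apply: leq_sum => j _; apply: leq_trans (bin_le_central _ (lo + j)).
rewrite sum1dep_card -cards_draws subset_leq_card //; apply/subsetP=> U.
rewrite inE => /andP[DU /eqP eUj]; have /andP[lo_le le_w] := D_card _ DU.
move: DU; rewrite !inE => /andP[-> _] /=.
by rewrite -eUj /f inordK ?subnKC //; lia.
Qed.

(** By [bin_sqr], a set of size at least 2^(8b) has its central coefficient smaller than its number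
    of subsets by a factor 2^(4b); the [w.+1] admissible sizes give back at most 2^(3b). *)
Lemma card_balanced b w L B : L <= #|B| -> 2 ^ (8 * b) <= L -> w.+1 <= 2 ^ (3 * b) ->
  #|[set U : {set I} | (U \subset B) && balanced w U B]| * 2 ^ b <= 2 ^ #|B|.
Proof.
move=> leL geL le_w; have := card_balanced_bin w B; set c := #|[set U | _]|.
set C := 'C(_, _) => le_c.
have leC : C * 2 ^ (4 * b) <= 2 ^ #|B|.
  rewrite -(@leq_exp2r _ _ 2) // expnMn -!expnM [_ * 2]mulnC mulnA.
  rewrite [#|B| * 2]mulnC [2 ^ (2 * _)]expnM.
  apply: leq_trans (bin_sqr _ #|B|./2).
  by rewrite leq_mul2l (leq_trans geL) ?orbT // (leq_trans leL).
rewrite -(@leq_pmul2r (2 ^ (3 * b))) ?expn_gt0 // -mulnA -expnD.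
rewrite -{1}[b]mul1n -mulnDl.
apply: leq_trans (leq_mul le_c (leqnn _)) _; rewrite -mulnA mulnC.
by rewrite leq_mul.
Qed.

(** Passing to [X :\: B] in the recursive call is what makes the blocks pairwise disjoint. *)
Fixpoint blocks L X Bs := 
  if Bs is B :: Bs' then
    [&& B \subset X, L <= #|B| & blocks L (X :\: B) Bs']
  else true.

Lemma blocks_sub L X Bs B : blocks L X Bs -> B \in Bs -> B \subset X.
Proof.
elim: Bs X => //= C Bs IH X /and3P[sCX _ blBs]; rewrite inE => /predU1P[->//|BsB].
by apply: subset_trans (IH _ blBs BsB) (subsetDl _ _).
Qed.

Lemma blocksS L X (Y : {set I}) Bs : X \subset Y -> blocks L X Bs -> blocks L Y Bs.
Proof.
elim: Bs X Y => //= B Bs IH X Y sXY /and3P[sBX -> blBs].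
by rewrite (subset_trans sBX sXY) (IH _ _ _ blBs) ?setSD.
Qed.

(** Balance of a block depends only on the trace of [T] on it, and traces on disjoint blocks vary
    independently, so each block contributes its own factor 2^(-b). *)
Lemma card_all_balanced b w L X Bs : blocks L X Bs ->
  2 ^ (8 * b) <= L -> w.+1 <= 2 ^ (3 * b) ->
  #|[set T : {set I} | (T \subset X) && all (balanced w T) Bs]| * 2 ^ (b * size Bs)
    <= 2 ^ #|X|.
Proof.
move=> + geL le_w; elim: Bs X => [|B Bs IH] X /=.
  move=> _; rewrite muln0 muln1 -card_powerset subset_leq_card //.
  by apply/subsetP=> T; rewrite !inE andbT.
case/and3P=> sBX leL blBs; have {}IH := IH _ blBs.
set D := [set T | _]; set D1 := [set T | _] in IH.
pose D0 := [set U : {set I} | (U \subset B) && balanced w U B].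
have D0P : #|D0| * 2 ^ b <= 2 ^ #|B| by apply: card_balanced leL _ _.
have leD : #|D| <= #|D0| * #|D1|.
  pose h (T : {set I}) := (T :&: B, T :&: (X :\: B)).
  have h_inj : {in D &, injective h}.
    move=> T T'; rewrite !inE => /andP[sTX _] /andP[sTX' _] [e1 e2].
    have decomp (V : {set I}) : V \subset X -> V = (V :&: B) :|: (V :&: (X :\: B)).
      move=> /subsetP sVX; apply/setP=> i; rewrite !inE.
      by case: (boolP (i \in V)) => //= /sVX ->; rewrite andbT orbN.
    by rewrite (decomp T) // (decomp T') // e1 e2.
  rewrite -(card_in_imset h_inj) -cardsX subset_leq_card //.
  apply/subsetP=> _ /imsetP[T DT ->]; move: DT; rewrite !inE /= => /and3P[_ balB balBs].
  rewrite !subsetIr balancedI // balB /=.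
  apply/allP=> C BsC; rewrite balancedI; first exact: (allP balBs).
  exact: blocks_sub blBs BsC.
rewrite mulnS expnD mulnA [_ * 2 ^ b]mulnC -mulnA.
have -> : #|X| = #|B| + #|X :\: B|.
  by rewrite -(cardsID B X) (setIidPr sBX).
rewrite expnD; apply: leq_trans (leq_mul D0P IH).
by rewrite mulnACA mulnC mulnAC -mulnA leq_mul // mulnC.
Qed.

Lemma exists_blocks L t X : L * t <= #|X| ->
  exists2 Bs, size Bs = t & blocks L X Bs.
Proof.
elim: t X => [|t IH] X leX; first by exists [::].
have [B [sBX cB]] : exists B : {set I}, B \subset X /\ #|B| = L.
  have : 0 < #|[set A : {set I} | A \subset X & #|A| == L]|.
    by rewrite cards_draws bin_gt0; apply: leq_trans leX; rewrite leq_pmulr.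
  by case/card_gt0P=> B; rewrite inE => /andP[? /eqP ?]; exists B.
have [|Bs sz blBs] := IH (X :\: B).
  by have := cardsID B X; rewrite (setIidPr sBX); lia.
by exists (B :: Bs) => /=; rewrite ?sz // sBX cB leqnn blBs.
Qed.
End Balance.

Local Open Scope ring_scope.

(** * Decomposition of multilinear formulas *)

Section Dependence.
Variables (K : comNzRingType) (n : nat).
Implicit Types (V W X B : {set 'I_n}) (f g h : cube n -> K).

Definition dep V f := forall x y : cube n, {in V, x =1 y} -> f x = f y.

Lemma depS V W f : V \subset W -> dep V f -> dep W f.
Proof. by move=> /subsetP sVW fV x y exy; apply: fV => i /sVW /exy. Qed.

Lemma depM V f g : dep V f -> dep V g -> dep V (fun x => f x * g x).
Proof. by move=> fV gV x y exy; rewrite (fV x y) // (gV x y). Qed.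

Definition restr X (x : cube n) : cube n := [ffun i => (i \in X) && x i].

Lemma dep_restr V X f : dep V f -> dep (V :&: X) (fun x => f (restr X x)).
Proof.
move=> fV x y exy; apply: fV => i Vi; rewrite !ffunE.
by case: (boolP (i \in X)) => //= Xi; apply: exy; rewrite inE Vi.
Qed.

(** Over a field: rank at most one for the partition of the variables into [B] and its
    complement. *)
Definition splits B g := exists f f',
  [/\ dep B f, dep (~: B) f' & forall x, g x = f x * f' x].

Lemma dep_splits B g : dep (~: B) g -> splits B g.
Proof. by move=> gB; exists (fun=> 1), g; split=> // x; rewrite mul1r. Qed.

(* B is the block under construction, X the part of it still available to p,
   and h stands for the factors already split off, in the variables of B :\: X.
   Setting the variables outside X to 0 makes cancellations harmless: p computed
   by a sum node may depend on fewer variables than its summands. *)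
Definition decomposes L t X B s p :=
  exists (I : finType) (G : I -> cube n -> K), [/\ (#|I| <= s)%N,
    forall x, p (restr X x) = \sum_i G i x,
    forall i, dep X (G i) &
    forall i, exists Bs, [/\ size Bs = t, blocks L B Bs &
      forall h C, dep (B :\: X) h -> C \in Bs -> splits C (fun x => h x * G i x)]].

(** The open block [B] keeps at least half of its variables in [X]. Closing it leaves at least a
    quarter of them for the next one, hence the power of 4. Quantifying over [t], [X] and [B] gives
    the invariant needed for induction on formulas. *)
Definition decomposable L s p := forall t X B, X \subset B ->
  (#|B| <= 2 * #|X|)%N -> (L * 4 ^ t <= #|B|)%N -> decomposes L t X B s p.

(** A single term suffices: either no block is requested, or [p] has at most one variable and the
    blocks are chosen among the others. They lie in [X], so neither [h] nor the term depends on
    them. *)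
Lemma decomposes_single L t X B s p V : (0 < s)%N -> (0 < L)%N -> dep V p ->
  (t == 0%N) || (#|V| <= 1)%N -> X \subset B ->
  (#|B| <= 2 * #|X|)%N -> (L * 4 ^ t <= #|B|)%N -> decomposes L t X B s p.
Proof.
move=> s_gt0 L_gt0 pV tV sXB leBX leB.
exists unit, (fun _ x => p (restr X x)); split=> [|x|_|_].
- by rewrite card_unit.
- by rewrite big_const card_unit /= addr0.
- by apply: (depS _ (dep_restr pV)); apply: subsetIr.
have [Bs szBs blBs] : exists2 Bs, size Bs = t & blocks L (X :\: V) Bs.
  apply: exists_blocks; case: t leB tV => [|t] leB tV; first by rewrite muln0.
  (* There are [t.+1] blocks to find; the spare [L] in [L * t.+2] makes up for the variable in
     [V]. *)
  have le_t : (2 * t.+2 <= 4 ^ t.+1)%N.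
    by elim: (t) => // u IH; rewrite expnS; lia.
  have : (L * (2 * t.+2) <= 2 * #|X|)%N.
    by rewrite (leq_trans _ leBX) // (leq_trans _ leB) // leq_mul2l le_t orbT.
  have := subset_leq_card (subsetIr X V); have := cardsID V X; lia.
exists Bs; split=> //; first by apply: blocksS blBs; rewrite (subset_trans (subsetDl _ _)).
move=> h C hX BsC; apply: dep_splits; have sC := blocks_sub blBs BsC.
apply: depM.
  apply: (depS _ hX); apply/subsetP=> i; rewrite !inE => /andP[nXi _].
  by apply: contra nXi => /(subsetP sC); rewrite !inE => /andP[].
apply: (depS _ (dep_restr pV)); apply/subsetP=> i; rewrite !inE => /andP[Vi _].
by apply/negP=> /(subsetP sC); rewrite !inE Vi.
Qed.

Lemma decomposableD L s1 s2 p1 p2 : decomposable L s1 p1 -> decomposable L s2 p2 ->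
  decomposable L (s1 + s2) (fun x => p1 x + p2 x).
Proof.
move=> D1 D2 t X B sXB leBX leB.
have [I1 [G1 [c1 e1 d1 b1]]] := D1 t X B sXB leBX leB.
have [I2 [G2 [c2 e2 d2 b2]]] := D2 t X B sXB leBX leB.
pose G (i : I1 + I2) := match i with inl i1 => G1 i1 | inr i2 => G2 i2 end.
exists (I1 + I2)%type, G; split; try by case.
  by rewrite card_sum leq_add.
by move=> x; rewrite big_sumType e1 e2.
Qed.

(** Only the factor with more live variables is expanded; the other one multiplies every term, so
    the number of terms does not grow. *)
Lemma decomposes_mul L s p1 p2 V1 V2 t X B : (0 < s)%N -> (0 < L)%N ->
  decomposable L s p1 -> dep V1 p1 -> dep V2 p2 -> V1 :&: V2 = set0 ->
  (#|V2 :&: X| <= #|V1 :&: X|)%N ->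
  X \subset B -> (#|B| <= 2 * #|X|)%N -> (L * 4 ^ t <= #|B|)%N ->
  decomposes L t X B s (fun x => p1 x * p2 x).
Proof.
move=> s_gt0 L_gt0 D1 p1V p2V dV leV sXB leBX leB.
case: t leB => [|t] leB.
  apply: decomposes_single leBX leB => //; apply: (@depM [set: _]) => //.
    by apply: (depS _ p1V); apply: subsetT.
  by apply: (depS _ p2V); apply: subsetT.
pose X' := X :\: V2; pose g2 x := p2 (restr X x).
have sX'X : X' \subset X by apply: subsetDl.
(* [X'] contains the live variables of [p1], which are at least as many as those of [p2] just
   dropped. *)
have leX : (#|X| <= 2 * #|X'|)%N.
  have : (#|V1 :&: X| <= #|X'|)%N.
    apply/subset_leq_card/subsetP=> i; rewrite !inE => /andP[V1i ->]; rewrite andbT.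
    by apply/negP=> V2i; have := in_set0 i; rewrite -dV inE V1i V2i.
  by have := cardsID V2 X; rewrite -/X' setIC; lia.
have p1E x : p1 (restr X x) = p1 (restr X' x).
  apply: p1V => i V1i; rewrite !ffunE !inE.
  suff -> : i \notin V2 by [].
  by apply/negP=> V2i; have := in_set0 i; rewrite -dV inE V1i V2i.
have g2V : dep (X :\: X') g2.
  apply: (depS _ (dep_restr p2V)); apply/subsetP=> i; rewrite !inE => /andP[-> ->] //.
(* If half of [B] survives, the block stays open and [g2] is absorbed into [h]. Otherwise [B :\: X']
   is closed as a block and a new one is opened on [X']. *)
have [leBX'|ltX'B] := leqP (#|B|) (2 * #|X'|).
  have [I [G [cI eG dG bG]]] := D1 t.+1 X' B (subset_trans sX'X sXB) leBX' leB.
  exists I, (fun i x => g2 x * G i x); split=> // [x|i|i].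
  - by rewrite p1E eG mulrC mulr_sumr.
  - apply: depM; first by apply: (depS _ g2V); apply: subsetDl.
    exact: (depS _ (dG i)).
  have [Bs [szBs blBs spBs]] := bG i; exists Bs; split=> // h C hX BsC.
  have [|f [f' [fC f'C E]]] := spBs (fun x => h x * g2 x) C _ BsC.
    apply: depM; first by apply: (depS _ hX); apply: setDS.
    by apply: (depS _ g2V); apply: setSD.
  by exists f, f'; split=> // x; rewrite mulrA E.
have leX' : (L * 4 ^ t <= #|X'|)%N.
  by move: leB; rewrite expnS; lia.
have [I [G [cI eG dG bG]]] := D1 t X' X' (subxx _) ltac:(lia) leX'.
exists I, (fun i x => g2 x * G i x); split=> // [x|i|i].
- by rewrite p1E eG mulrC mulr_sumr.
- apply: depM; first by apply: (depS _ g2V); apply: subsetDl.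
  exact: (depS _ (dG i)).
have [Bs [szBs blBs spBs]] := bG i; exists ((B :\: X') :: Bs); split=> /=.
- by rewrite szBs.
- rewrite subsetDl /=; apply/andP; split.
    have := cardsID X' B; rewrite (setIidPr (subset_trans sX'X sXB)).
    have : (L <= L * 4 ^ t)%N by rewrite leq_pmulr ?expn_gt0.
    move: leB ltX'B; rewrite expnS mulnCA; set q := (L * 4 ^ t)%N.
    by move: q #|B| #|X'| #|_ :\: _| => q b x d; clear; lia.
  by rewrite setDDr setDv set0U (setIidPr (subset_trans sX'X sXB)).
move=> h C hX; rewrite inE => /predU1P[->|BsC].
  (* On the closed block, [h] and [g2] involve only variables of [B :\: X'], while the remaining
     term lives on [X']. *)
  exists (fun x => h x * g2 x), (G i); split.
  - apply: depM; first by apply: (depS _ hX); apply: setDS.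
    by apply: (depS _ g2V); apply: setSD.
  - by apply: (depS _ (dG i)); apply/subsetP=> j; rewrite !inE => ->.
  by move=> x; rewrite mulrA.
have sC := blocks_sub blBs BsC.
have [f [f' [fC f'C E]]] := spBs (fun=> 1) C (fun _ _ _ => erefl) BsC.
exists f, (fun x => h x * g2 x * f' x); split=> // [|x]; last first.
  by rewrite mulrA -[G i x]mul1r E mulrCA.
apply: depM f'C; apply: depM.
  apply: (depS _ hX); apply/subsetP=> j; rewrite !inE => /andP[nXj _].
  by apply: contra nXj => /(subsetP sC)/(subsetP sX'X).
apply: (depS _ g2V); apply/subsetP=> j; rewrite !inE => /andP[nXj Xj].
by apply/negP=> /(subsetP sC); rewrite inE Xj andbT => nV; rewrite Xj andbT nV in nXj.
Qed.

Lemma decomposableM L s1 s2 p1 p2 V1 V2 : (0 < s1)%N -> (0 < s2)%N -> (0 < L)%N ->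
  decomposable L s1 p1 -> decomposable L s2 p2 ->
  dep V1 p1 -> dep V2 p2 -> V1 :&: V2 = set0 ->
  decomposable L (s1 + s2) (fun x => p1 x * p2 x).
Proof.
move=> s1_gt0 s2_gt0 L_gt0 D1 D2 p1V p2V dV t X B sXB leBX leB.
have [le21|/ltnW le12] := leqP (#|V2 :&: X|) (#|V1 :&: X|).
  have [I [G [cI eG dG bG]]] :=
    decomposes_mul s1_gt0 L_gt0 D1 p1V p2V dV le21 sXB leBX leB.
  by exists I, G; split=> //; apply: leq_trans cI (leq_addr _ _).
rewrite setIC in dV.
have [I [G [cI eG dG bG]]] :=
  decomposes_mul s2_gt0 L_gt0 D2 p2V p1V dV le12 sXB leBX leB.
exists I, G; split=> // [|x]; first by apply: leq_trans cI (leq_addl _ _).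
by rewrite -eG mulrC.
Qed.

End Dependence.

Definition degs_le (K : nzRingType) n (a : 'I_n -> nat) (p : mpoly n K) :=
  forall m : multinom n, m \in msupp p -> forall i, (m i <= a i)%N.

Lemma multilinearP (K : nzRingType) n (p : mpoly n K) :
  reflect (degs_le (fun=> 1%N) p) (multilinear p).
Proof.
apply: (iffP allP) => mlp m pm; first by move=> i; have /forallP/(_ i) := mlp m pm.
by apply/forallP=> i; apply: mlp.
Qed.

(** * Degrees in one variable, and the factors of a multilinear product *)

Section Variables.
Variables (K : idomainType) (n : nat).
Implicit Types (p q : mpoly n K) (i : 'I_n).

Definition mvars p : {set 'I_n} := [set i | has (fun m : multinom n => m i != 0%N) (msupp p)].

Lemma dep_mvars p : dep (mvars p) (cube_eval p).
Proof.
move=> x y exy; rewrite /cube_eval !mevalE; apply: eq_big_seq => m pm.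
congr (_ * _); apply: eq_bigr => i _.
have [mi0|mi] := eqVneq (m i) 0%N; first by rewrite mi0 !expr0.
by rewrite exy // inE; apply/hasP; exists m.
Qed.

(* The substitution X_i := 'X * X_i, which turns the degree in X_i into the
   degree of a univariate polynomial. *)
Definition split_var i : mpoly n K -> {poly (mpoly n K)} :=
  mmap (polyC \o @mpolyC n K) (fun j => 'X ^+ (j == i) * (mpolyX K (mnm1 j))%:P).

Lemma split_varM i p q : split_var i (p * q) = split_var i p * split_var i q.
Proof. exact: rmorphM. Qed.

Lemma split_varE i p :
  split_var i p =
    \sum_(m <- msupp p) (mcoeff m p *: mpolyX K m) *: 'X^(m i).
Proof.
rewrite /split_var /mmap; apply: eq_bigr => m _ /=.
rewrite /mmap1 (eq_bigr (fun j => 'X ^+ ((j == i) * m j) * (mpolyX K (mnm1 j) ^+ m j)%:P)).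
  rewrite big_split /= -[X in _ * (_ * X)]rmorph_prod /= -mpolyXE_id.
  rewrite (bigD1 i) //= eqxx mul1n big1 => [|j /negPf -> //]; rewrite ?mulr1.
  by rewrite mulrCA mulrC -mul_polyC -mul_mpolyC polyCM.
by move=> j _; rewrite exprMn -exprM mulnC polyC_exp mulnC.
Qed.

(** The coefficient of degree [k] keeps its power of X_i, so distinct monomials of [p] never
    merge. *)
Lemma coef_split_var i p k (m : multinom n) :
  mcoeff m (split_var i p)`_k = if m i == k then mcoeff m p else 0.
Proof.
rewrite split_varE coef_sum raddf_sum /=.
under eq_bigr => m' _ do rewrite coefZ coefXn -scalerAl mcoeffZ mulr_natr mcoeffMn mcoeffX.
have [pm|npm] := boolP (m \in msupp p).
  rewrite (bigD1_seq m) //= big1_seq ?addr0 => [|m' /andP[m'm _]]; last first.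
    by rewrite (negPf m'm) mul0rn mulr0.
  rewrite eqxx eq_sym.
  by case: (m i == k); rewrite ?mulr1 ?mulr0.
rewrite big1_seq => [|m' /andP[_ pm']]; last first.
  have [e|_] := eqVneq m' m; first by rewrite -e pm' in npm.
  by rewrite mul0rn mulr0.
by rewrite (memN_msupp_eq0 npm) if_same.
Qed.

Lemma size_split_var_gt1 i p : i \in mvars p -> (1 < size (split_var i p))%N.
Proof.
rewrite inE => /hasP[m pm mi]; have : (split_var i p)`_(m i) != 0.
  apply: contraTneq pm => c0; rewrite -mcoeff_eq0.
  by have := coef_split_var i p (m i) m; rewrite eqxx c0 mcoeff0 => <-.
apply: contraNT; rewrite -leqNgt => szp; rewrite nth_default //.
by apply: leq_trans szp _; rewrite lt0n.
Qed.

Lemma size_split_var_le2 i p : multilinear p -> (size (split_var i p) <= 2)%N.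
Proof.
move=> /multilinearP mlp; apply/leq_sizeP => j le2j; apply/mpolyP => m.
rewrite coef_split_var mcoeff0; case: eqP => // mi.
have [/mlp/(_ i)|/memN_msupp_eq0 //] := boolP (m \in msupp p).
by rewrite mi leqNgt le2j.
Qed.

Lemma size_mul_gt2 (A : idomainType) (P Q : {poly A}) :
  (1 < size P)%N -> (1 < size Q)%N -> (2 < size (P * Q)%R)%N.
Proof.
move=> P1 Q1; rewrite size_mul -?size_poly_gt0 ?(ltnW P1) ?(ltnW Q1) //.
by move: P1 Q1; case: (size P) => [|[|a]] //; case: (size Q) => [|[|b]] //; rewrite !addnS.
Qed.

(** Over an integral domain degrees in X_i add, so a variable occurring in both factors would have
    degree at least 2 in the product. *)
Lemma mvars_disjoint p q : multilinear (p * q) ->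
  mvars p :&: mvars q = set0.
Proof.
move=> mlpq; apply/setP=> i; rewrite in_setI in_set0; apply/negP=> /andP[pi qi].
have := size_split_var_le2 i mlpq; rewrite split_varM leqNgt => /negP[].
exact: size_mul_gt2 (size_split_var_gt1 pi) (size_split_var_gt1 qi).
Qed.

Lemma dep_mul p q : multilinear (p * q) -> exists V W : {set 'I_n},
  [/\ dep V (cube_eval p), dep W (cube_eval q) & V :&: W = set0].
Proof.
move=> mlpq; exists (mvars p), (mvars q); split; try exact: dep_mvars.
exact: mvars_disjoint.
Qed.

Lemma formula_size_gt0 (F : formula K n) : (0 < formula_size F)%N.
Proof. by elim: F => //= F1 IH1 F2 _; rewrite addn_gt0 IH1. Qed.

Lemma multilinear_formula_decomposable L (F : formula K n) : (0 < L)%N ->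
  multilinear_formula F ->
  decomposable L (formula_size F) (cube_eval (formula_poly F)).
Proof.
move=> L_gt0; elim: F => [c|i|F1 IH1 F2 IH2|F1 IH1 F2 IH2] /=.
- move=> _ t X B; apply: (@decomposes_single _ _ _ _ _ _ _ _ set0) => //.
    by move=> x y _; rewrite /cube_eval !mevalC.
  by rewrite cards0 orbT.
- move=> _ t X B; apply: (@decomposes_single _ _ _ _ _ _ _ _ [set i]) => //.
    by move=> x y exy; rewrite /cube_eval !mevalXU exy // inE.
  by rewrite cards1 orbT.
- move=> /and3P[_ ml1 ml2].
  rewrite (_ : cube_eval _ = fun x => cube_eval (formula_poly F1) x +
     cube_eval (formula_poly F2) x); first by apply: decomposableD; auto.
  by apply/funext=> x; rewrite /cube_eval mevalD.
- move=> /and3P[mlM ml1 ml2]; have [V [W [dV dW VW]]] := dep_mul mlM.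
  rewrite (_ : cube_eval _ = fun x => cube_eval (formula_poly F1) x *
     cube_eval (formula_poly F2) x).
    by apply: decomposableM dV dW VW => //; auto using formula_size_gt0.
  by apply/funext=> x; rewrite /cube_eval mevalM.
Qed.

End Variables.

(** * Rank with respect to a partition of the variables *)

Section Separable.
Variables (K : comNzRingType) (n : nat).
Implicit Types (T B : {set 'I_n}) (f g : cube n -> K).

(** Over a field: rank at most [r] for the matrix with rows indexed by assignments to [T] and
    columns by assignments to [~: T]. An arbitrary finite index type lets sums and products of
    decompositions use sum and product types. *)
Definition separable T r g := exists (I : finType) (u v : I -> cube n -> K),
  [/\ (#|I| <= r)%N, forall i, dep T (u i), forall i, dep (~: T) (v i) &
      forall x, g x = \sum_i u i x * v i x].

Lemma separableC T r g : separable (~: T) r g -> separable T r g.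
Proof.
case=> I [u [v [cI uT vT gE]]]; exists I, v, u; split=> // [i|x].
  by have := vT i; rewrite setCK.
by rewrite gE; apply: eq_bigr => i _; rewrite mulrC.
Qed.

Lemma separable_leq T r r' g : (r <= r')%N -> separable T r g -> separable T r' g.
Proof.
move=> le_r [I [u [v [cI uT vT gE]]]]; exists I, u, v; split=> //.
exact: leq_trans cI le_r.
Qed.

Lemma separableM T r r' f g : separable T r f -> separable T r' g ->
  separable T (r * r') (fun x => f x * g x).
Proof.
move=> [I [u [v [cI uT vT fE]]]] [J [u' [v' [cJ uT' vT' gE]]]].
exists (I * J)%type, (fun ij x => u ij.1 x * u' ij.2 x),
  (fun ij x => v ij.1 x * v' ij.2 x); split=> [|ij|ij|x].
- by rewrite card_prod leq_mul.
- exact: depM.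
- exact: depM.
rewrite fE gE mulr_suml -(pair_bigA _ (fun i j => u i x * u' j x * (v i x * v' j x))) /=.
apply: eq_bigr => i _; rewrite mulr_sumr; apply: eq_bigr => j _.
by rewrite mulrACA.
Qed.

Lemma separable_sum T r (J : Type) (s : seq J) (G : J -> cube n -> K) :
  (forall j, separable T r (G j)) ->
  separable T (size s * r) (fun x => \sum_(j <- s) G j x).
Proof.
move=> sepG; elim: s => [|j s [I [u [v [cI uT vT fE]]]]] /=.
  exists void, (fun _ _ => 0), (fun _ _ => 0); split=> // [|x]; first by rewrite card_void.
  by rewrite big_nil big1 // => -[].
have [I' [u' [v' [cI' uT' vT' fE']]]] := sepG j.
exists (I' + I)%type, (fun i => match i with inl i' => u' i' | inr i => u i end),
  (fun i => match i with inl i' => v' i' | inr i => v i end).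
split; try by case.
  by rewrite card_sum mulSn leq_add.
by move=> x; rewrite big_cons big_sumType fE fE'.
Qed.

(** One term per trace [a] on [B :&: T]: the indicator of that trace times [f] with its [T]
    coordinates fixed to [a]. *)
Lemma dep_separable T B f : dep B f -> separable T (2 ^ #|B :&: T|) f.
Proof.
move=> fB; pose I := {a : {set 'I_n} | a \in powerset (B :&: T)}.
pose tr (x : cube n) := [set i in B :&: T | x i].
exists I, (fun (a : I) (x : cube n) => (tr x == val a)%:R),
  (fun (a : I) (x : cube n) => f [ffun i => if i \in T then i \in val a else x i]).
split=> [|a x y exy|a x y exy|x].
- by rewrite card_sig card_powerset.
- suff -> : tr x = tr y by [].
  apply/setP=> i; rewrite !inE; case: (boolP (i \in T)) => Ti; rewrite ?andbF //.
  by rewrite exy.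
- congr f; apply/ffunP=> i; rewrite !ffunE; case: ifP => // Ti.
  by apply: exy; rewrite inE Ti.
have tr_in : tr x \in powerset (B :&: T).
  by rewrite inE; apply/subsetP=> i; rewrite inE => /andP[].
rewrite (bigD1 (Sub (tr x) tr_in : I)) //= eqxx mul1r big1 ?addr0 => [|a].
  apply: fB => i Bi; rewrite ffunE; case: ifP => // Ti.
  by rewrite !inE Bi Ti.
by rewrite -val_eqE /= eq_sym => /negPf->; rewrite mul0r.
Qed.

(** Each factor may be expanded along either side of the partition. Expanding [f] on the smaller
    side of [B] and [f'] on the opposite side of [~: B] gives exponents whose sum misses [k] by more
    than [w]. *)
Lemma splits_separable T B w k g : splits B g -> #|T| = k -> #|~: T| = k ->
  ~~ balanced w T B -> separable T (2 ^ (k - w)) g.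
Proof.
move=> [f [f' [fB f'B gE]]] cT cT'.
have g_ext r : separable T r (fun x => f x * f' x) -> separable T r g.
  by case=> I [u [v [cI uT vT E]]]; exists I, u, v; split=> // x; rewrite gE.
have cardB : (#|B :&: T| + #|~: B :&: T| = k)%N.
  by rewrite -cT -(cardsID B T) !(setIC _ T) setDE.
have cardB' : (#|B :\: T| + #|~: B :&: ~: T| = k)%N.
  by rewrite -cT' -(cardsID B (~: T)) setDE !(setIC _ (~: T)) setDE.
rewrite /balanced negb_and -!ltnNge => /orP[] ltw; apply: g_ext.
  apply: separable_leq (separableM (separableC (dep_separable (~: T) fB))
    (dep_separable T f'B)).
  rewrite -expnD leq_exp2l // -setDE.
  by move: ltw cardB; move: #|_| #|_| #|_| => a b c; clear; lia.
apply: separable_leq (separableM (dep_separable T fB)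
  (separableC (dep_separable (~: T) f'B))).
rewrite -expnD leq_exp2l //.
by move: ltw cardB'; move: #|_| #|_| #|_| => a b c; clear; lia.
Qed.
End Separable.

(** * Frobenius distance from low-rank matrices to scalar matrices *)

Section Frobenius.
Variables (C : numClosedFieldType).
Local Open Scope sesquilinear_scope.

Lemma trmxC_norm m n (A : 'M[C]_(m, n)) :
  \tr (A *m A ^t*) = \sum_i \sum_j `|A i j| ^+ 2.
Proof.
apply: eq_bigr => i _; rewrite mxE; apply: eq_bigr => j _.
by rewrite !mxE normCK.
Qed.

(** On the left kernel of [M], of dimension [N - \rank M], the error [E] acts as multiplication by
    [- c]; restricting to an orthonormal basis [Q] of it cannot increase the Frobenius norm. *)
Lemma rank_approx_scalar N (M : 'M[C]_N) (c e : C) :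
  \sum_i \sum_j `|M i j - c *+ (i == j)| ^+ 2 <= e ->
  (N - \rank M)%:R * `|c| ^+ 2 <= e.
Proof.
pose E := M - c%:M; set q := (N - _)%N => leE.
have {leE} leE : \tr (E *m E ^t*) <= e.
  rewrite trmxC_norm; under eq_bigr do under eq_bigr do rewrite !mxE.
  exact: leE.
have [Q [Qu QM]] : exists Q : 'M[C]_(q, N), Q \is unitarymx /\ Q *m M = 0.
  rewrite /q -mxrank_ker; exists (schmidt (row_base (kermx M))).
  split; first by rewrite schmidt_unitarymx // rank_leq_col.
  apply/sub_kermxP; rewrite eqmx_schmidt_free ?row_base_free //.
  by rewrite eq_row_base.
have QE : Q *m E = - c *: Q by rewrite mulmxBr QM sub0r mul_mx_scalar scaleNr.
have trQ : \tr (Q *m E *m (Q *m E) ^t*) = q%:R * `|c| ^+ 2.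
  rewrite QE !linearZ /= map_mxZ -scalemxAl -scalemxAr scalerA (unitarymxP Qu).
  by rewrite mxtraceZ mxtrace1 mulrC rmorphN mulrNN -normCK.
rewrite -trQ; apply: le_trans leE.
(* [P] projects onto the orthogonal complement of the rows of [Q]; the squared norm of [P *m E] is
   exactly the loss in passing from [E] to [Q *m E]. *)
pose P := 1%:M - Q ^t* *m Q.
have Psym : P ^t* = P.
  rewrite /P linearB /= trmx1 trmx_mul map_mxB map_mx1 map_mxM.
  by rewrite -map_trmx trmxK map_mxCK.
have Pidem : P *m P = P.
  rewrite {2}/P mulmxBr mulmx1 mulmxA mulmxBl mul1mx -(mulmxA _ Q).
  by rewrite (unitarymxP Qu) mulmx1 subrr mul0mx subr0.
have PE_ge0 : 0 <= \tr (P *m E *m (P *m E) ^t*).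
  rewrite trmxC_norm; do 2!apply: sumr_ge0 => ? _; exact: exprn_ge0.
rewrite -subr_ge0; apply: le_trans PE_ge0 _.
rewrite !trmx_mul !map_mxM /= [X in X <= _]mxtrace_mulC Psym.
rewrite -!mulmxA (mulmxA P P) Pidem (mxtrace_mulC Q) -!mulmxA !(mxtrace_mulC E).
rewrite -linearB /= /P mulmxBl mulmxBr mul1mx.
by rewrite -!mulmxA.
Qed.
End Frobenius.

Section SeparableRank.
Variables (C : numClosedFieldType) (n : nat).

(* On the graph of a bijection between the two halves of the cube, a function
   of x and y is a matrix, and the indicator of the graph is the identity. *)
Lemma separable_approx_indicator (S : {set cube n}) (T : {set 'I_n}) r
    (g : cube n -> C) (c e : C) :
  {in S &, forall x y : cube n, {in T, x =1 y} -> x = y} ->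
  {in S &, forall x y : cube n, {in ~: T, x =1 y} -> x = y} ->
  separable T r g ->
  \sum_x `|g x - c *+ (x \in S)| ^+ 2 <= e ->
  (#|S| - r)%:R * `|c| ^+ 2 <= e.
Proof.
move=> injT injC [I [u [v [cI uT vT gE]]]] leE.
pose comb (x y : cube n) : cube n := [ffun i => if i \in T then x i else y i].
have combT x y : {in T, comb x y =1 x} by move=> i Ti; rewrite ffunE Ti.
have combC x y : {in ~: T, comb x y =1 y}.
  by move=> i; rewrite inE ffunE => /negPf ->.
pose s (i : 'I_#|S|) : cube n := enum_val i.
have sS i : s i \in S by apply: enum_valP.
have s_inj : injective s by apply: enum_val_inj.
pose M := \matrix_(i, j) g (comb (s i) (s j)).
have rkM : (\rank M <= r)%N.
  pose U := \matrix_(i < #|S|, a < #|I|) u (enum_val a) (s i).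
  pose V := \matrix_(a < #|I|, j < #|S|) v (enum_val a) (s j).
  have -> : M = U *m V.
    apply/matrixP=> i j; rewrite !mxE gE (reindex (@enum_val I predT)) /=; last first.
      by apply: onW_bij; apply: enum_val_bij.
    by apply: eq_bigr => a _; rewrite !mxE (uT _ _ _ (combT _ _)) (vT _ _ _ (combC _ _)).
  by apply: leq_trans cI; apply: leq_trans (mxrankM_maxl _ _) (rank_leq_col _).
(* A mixture of two points of [S] lies in [S] only if they coincide, so the indicator of [S] becomes
   the identity matrix. *)
have combS i j : (comb (s i) (s j) \in S) = (i == j).
  apply/idP/eqP=> [cS|<-]; last first.
    suff -> : comb (s i) (s i) = s i by [].
    by apply/ffunP=> a; rewrite ffunE if_same.
  apply: s_inj; rewrite -(injT _ _ cS (sS i) (combT _ _)).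
  exact: injC cS (sS j) (combC _ _).
(* Distinct entries of [M] are values of [g] at distinct points, so the matrix error is part of the
   error over the cube. *)
have comb_inj : injective (fun ij => comb (s ij.1) (s ij.2)).
  move=> [i j] [i' j'] /= /ffunP e_comb; congr (_, _); apply: s_inj.
    apply: injT => // a Ta.
    by have := e_comb a; rewrite (combT _ _ _ Ta) (combT _ _ _ Ta).
  apply: injC => // a Ta.
  by have := e_comb a; rewrite (combC _ _ _ Ta) (combC _ _ _ Ta).
have leM : \sum_i \sum_j `|M i j - c *+ (i == j)| ^+ 2 <= e.
  apply: le_trans leE; rewrite pair_bigA /=.
  under eq_bigr => ij _ do rewrite mxE -combS.
  rewrite -(big_imset (fun x => `|g x - c *+ (x \in S)| ^+ 2) (in2W comb_inj)) /=.
  rewrite [X in _ <= X](bigID (mem [set comb (s ij.1) (s ij.2) | ij in predT])) /=.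
  by rewrite lerDl sumr_ge0 // => x _; apply: exprn_ge0.
apply: le_trans (rank_approx_scalar leM).
by rewrite ler_wpM2r ?exprn_ge0 // ler_nat leq_sub2l.
Qed.
End SeparableRank.

(** * Random matrices over the field with two elements *)

(** After division: the product of the 1 - 2^(-i) for i <= k is at least 1/4 + 2^(-k-1). The second
    summand strengthens the bound 1/4 enough for induction. *)
Lemma prod_pow2_pred_ge k : (0 < k)%N ->
  (2 ^ 'C(k.+1, 2) * (2 ^ k + 2) <= 4 * 2 ^ k * \prod_(1 <= i < k.+1) (2 ^ i - 1))%N.
Proof.
case: k => // k _; elim: k => [|k IH]; first by rewrite big_nat1.
rewrite big_nat_recr //= binS bin1 expnD [(2 ^ k.+2)%N]expnS.
have : (2 <= 2 ^ k.+1)%N by rewrite (leq_exp2l 1).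
move: IH; set P := \prod_(_ <= _ < _) _; move: (2 ^ k.+1)%N (2 ^ 'C(_, _))%N => q d.
nia.
Qed.

Lemma card_unitmx_F2 k : (0 < k)%N ->
  (2 ^ (k * k) <= 4 * #|[set M : 'M['F_2]_k | M \in unitmx]|)%N.
Proof.
move=> k_gt0; have := card_GL 'F_2 k_gt0; rewrite card_Fp //.
have -> : #|'GL_k['F_2]%g| = #|[set M : 'M['F_2]_k | M \in unitmx]|.
  case: k k_gt0 => // k _.
  rewrite -(card_imset _ val_inj); apply: eq_card => M; rewrite inE.
  apply/imsetP/idP => [[u _ ->]|uM]; first exact: (valP u).
  by exists (Sub M uM); rewrite ?inE ?SubK.
move=> ->; have := prod_pow2_pred_ge k_gt0.
set P := \prod_(_ <= _ < _) _ => leP.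
have -> : (k * k = 'C(k, 2) + 'C(k.+1, 2))%N.
  by elim: (k) => // m IH; rewrite binS bin1 [in RHS]binS bin1 mulSn mulnS IH binS bin1; lia.
rewrite expnD mulnCA leq_mul2l; apply/orP; right.
rewrite -(@leq_pmul2r (2 ^ k)) ?expn_gt0 //.
by apply: leq_trans (leq_trans _ leP) _; rewrite ?leq_mul2l ?leq_addr ?orbT // mulnAC.
Qed.

(** * Kernels determined by either half of the coordinates *)

Section Halves.
Variables (k n : nat).
Hypothesis nE : n = (k + k)%N.
Implicit Types (T : {set 'I_n}) (A : 'M['F_2]_(k, n)).

Lemma half_bij T : #|T| = k -> exists e : 'I_k + 'I_k -> 'I_n,
  bijective e /\ forall a, (e a \in T) = if a is inl _ then true else false.
Proof.
move=> cT; have cT' : #|~: T| = k.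
  by apply: (@addnI k); rewrite -{1}cT cardsC card_ord.
pose e (a : 'I_k + 'I_k) : 'I_n := match a with
  | inl i => enum_val (cast_ord (esym cT) i)
  | inr i => enum_val (cast_ord (esym cT') i) end.
have eT a : (e a \in T) = if a is inl _ then true else false.
  case: a => i /=; first exact: enum_valP.
  by have := enum_valP (cast_ord (esym cT') i); rewrite inE => /negPf.
exists e; split=> //; apply: inj_card_bij; last first.
  by rewrite card_sum !card_ord -nE.
move=> a b eab; have := eT a; rewrite eab eT.
by case: a b eab => [i|i] [j|j] //= /enum_val_inj /cast_ord_inj ->.
Qed.

Definition halves_separate A T : Prop :=
  {in kernel_set A &, forall x y : cube n, {in T, x =1 y} -> x = y} /\
  {in kernel_set A &, forall x y : cube n, {in ~: T, x =1 y} -> x = y}.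

Lemma kernel_setP A (x : cube n) :
  reflect (forall i, \sum_j A i j * (x j)%:R = 0) (x \in kernel_set A).
Proof.
rewrite inE; apply: (iffP eqP) => [/matrixP Ax i|Ax].
  have := Ax i ord0; rewrite !mxE; apply: etrans.
  by apply: eq_bigr => j _; rewrite mxE.
apply/matrixP=> i j; rewrite !mxE -[RHS](Ax i).
by apply: eq_bigr => l _; rewrite mxE.
Qed.

Lemma boolF2_inj : injective (fun b : bool => b%:R : 'F_2).
Proof. by move=> [] []. Qed.

(** The difference of [x] and [y] is supported off [U] and is killed by the columns there, which
    form an invertible matrix. *)
Lemma kernel_set_eq A (U : {set 'I_n}) (f : 'I_k -> 'I_n) (x y : cube n) :
  injective f -> f @: 'I_k = ~: U -> colsub f A \in unitmx ->
  x \in kernel_set A -> y \in kernel_set A -> {in U, x =1 y} -> x = y.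
Proof.
move=> f_inj fU uA /kernel_setP Ax /kernel_setP Ay exy.
pose z := \col_j ((x (f j))%:R - (y (f j))%:R : 'F_2).
have z0 : z = 0.
  rewrite -[z](mulKmx uA); suff -> : colsub f A *m z = 0 by rewrite mulmx0.
  apply/matrixP=> i j; rewrite !mxE.
  have := Ax i; rewrite -[X in _ = X](Ay i) => /eqP; rewrite -subr_eq0 -sumrB => /eqP.
  apply: etrans; rewrite [RHS](bigID (mem U)) /= [X in X + _]big1 ?add0r => [|l Ul].
    2: by rewrite (exy l Ul) subrr.
  have -> : \sum_(l | l \notin U) (A i l * (x l)%:R - A i l * (y l)%:R) =
     \sum_(l in f @: 'I_k) (A i l * (x l)%:R - A i l * (y l)%:R).
    by apply: eq_bigl => l; rewrite fU inE.
  rewrite big_imset /=; last by move=> a b _ _; apply: f_inj.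
  by apply: eq_bigr => l _; rewrite !mxE mulrBr.
apply/ffunP=> l; have [/exy //|Ul] := boolP (l \in U).
have : l \in f @: 'I_k by rewrite fU inE.
case/imsetP=> a _ ->; apply: boolF2_inj; apply/eqP; rewrite -subr_eq0.
by have /matrixP/(_ a ord0) := z0; rewrite !mxE => ->.
Qed.

(** The two halves of the columns are independent and each is invertible with probability at least
    1/4; [h] glues such a pair into a matrix. *)
Lemma card_halves_separate T : (0 < k)%N -> #|T| = k ->
  (2 ^ (k * n) <= 16 * #|[set A : 'M['F_2]_(k, n) | `[< halves_separate A T >]]|)%N.
Proof.
move=> k_gt0 cT; have [e [e_bij eT]] := half_bij cT; have [e' eK e'K] := e_bij.
set GL := [set M : 'M['F_2]_k | M \in unitmx].
pose h (GH : 'M['F_2]_k * 'M['F_2]_k) : 'M['F_2]_(k, n) :=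
  \matrix_(i, j) match e' j with inl a => GH.1 i a | inr a => GH.2 i a end.
have hl GH : colsub (e \o inl) (h GH) = GH.1.
  by apply/matrixP=> i j; rewrite !mxE /= eK.
have hr GH : colsub (e \o inr) (h GH) = GH.2.
  by apply/matrixP=> i j; rewrite !mxE /= eK.
have h_inj : injective h.
  by move=> [G H] [G' H'] eh; have := hl (G, H); have := hr (G, H);
    rewrite eh hl hr /= => -> ->.
have cG := card_unitmx_F2 k_gt0.
have : (#|h @: setX GL GL| <= #|[set A : 'M['F_2]_(k, n) | `[< halves_separate A T >]]|)%N.
  apply/subset_leq_card/subsetP=> _ /imsetP[GH + ->].
  rewrite !inE => /andP[uG uH]; apply/asboolP; split=> x y xA yA.
    apply: (@kernel_set_eq _ T (e \o inr)) xA yA; last by rewrite hr.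
      by move=> a b /(bij_inj e_bij) [].
    apply/setP=> i; rewrite inE -(e'K i) eT; apply/imsetP/idP.
      by case=> a _ /(bij_inj e_bij) ->.
    by case: (e' i) => // a _; exists a.
  have uhl : colsub (e \o inl) (h GH) \in unitmx .
    by rewrite hl; exact: uG.
  move=> exy.
  apply: kernel_set_eq uhl xA yA exy.
    by move=> a b /(bij_inj e_bij) [].
  apply/setP=> i; rewrite !inE negbK -(e'K i) eT; apply/imsetP/idP.
    by case=> a _ /(bij_inj e_bij) ->.
  by case: (e' i) => // a _; exists a.
rewrite card_imset // cardsX -/GL => leG; apply: leq_trans (leq_mul (leqnn 16) leG).
rewrite nE mulnDr expnD; apply: leq_trans (leq_mul cG cG) _.
by rewrite mulnACA.
Qed.

(** Every nonempty fiber of [A] is carried into the kernel by a translation, and there are 2^k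
    possible values. *)
Lemma card_kernel_set A : (2 ^ k <= #|kernel_set A|)%N.
Proof.
pose ev (x : cube n) := A *m \col_(i < n) ((x i)%:R : 'F_2).
have fiber b : (#|[set x | ev x == b]| <= #|kernel_set A|)%N.
  have [->|[x0]] := set_0Vmem [set x | ev x == b]; first by rewrite cards0.
  rewrite inE => /eqP ex0.
  pose tr (x : cube n) : cube n := [ffun i => x i (+) x0 i].
  have tr_inj : injective tr.
    move=> x y /ffunP exy; apply/ffunP=> i; have := exy i.
    by rewrite !ffunE => /addIb.
  rewrite -(card_imset _ tr_inj); apply/subset_leq_card/subsetP=> _ /imsetP[x + ->].
  rewrite !inE => /eqP ex.
  have -> : \col_(i < n) ((tr x i)%:R : 'F_2) = \col_(i < n) (x i)%:R - \col_(i < n) (x0 i)%:R.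
    apply/matrixP=> i j; rewrite !mxE ffunE.
    by case: (x i); case: (x0 i); apply/val_inj.
  by rewrite mulmxBr -/(ev x) -/(ev x0) ex ex0 subrr.
have : (\sum_(b : 'cV['F_2]_k) #|[set x | ev x == b]| = 2 ^ n)%N.
  rewrite -[RHS](_ : #|cube n| = _)%N; last by rewrite card_ffun card_bool card_ord.
  rewrite -sum1_card (partition_big ev predT) //=; apply: eq_bigr => b _.
  by rewrite sum1dep_card.
have : (\sum_(b : 'cV['F_2]_k) #|[set x | ev x == b]| <= 2 ^ k * #|kernel_set A|)%N.
  apply: (@leq_trans (\sum_(b : 'cV['F_2]_k) #|kernel_set A|)).
    by apply: leq_sum => b _; apply: fiber.
  by rewrite sum_nat_const card_mx card_Fp // muln1.
have -> : (2 ^ n = 2 ^ k * 2 ^ k)%N by rewrite nE expnD.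
by move=> + e2; rewrite e2 leq_pmul2l // expn_gt0.
Qed.

(** Averaging: by double counting, the mean over [A] of the fraction of separating [T] is at least
    1/16. Matrices with fraction below 1/32 contribute at most 1/32, so the others have density at
    least 1/32. *)
Lemma card_often_separating : (0 < k)%N ->
  (2 ^ (k * n) <= 32 * #|[set A : 'M['F_2]_(k, n) |
     #|[set T : {set 'I_n} | #|T| == k]| <=
     32 * #|[set T : {set 'I_n} | (#|T| == k) && `[< halves_separate A T >]]| ]|)%N.
Proof.
move=> k_gt0; set TT := [set T : {set 'I_n} | #|T| == k].
pose g (A : 'M['F_2]_(k, n)) := #|[set T : {set 'I_n} | (#|T| == k) && `[< halves_separate A T >]]|.
rewrite -/(g _); set N := #|[set A | _]|.
have cM : #|{: 'M['F_2]_(k, n)}| = (2 ^ (k * n))%N by rewrite card_mx card_Fp.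
have TT_gt0 : (0 < #|TT|)%N by rewrite card_draws card_ord bin_gt0 nE leq_addr.
have g_le A : (g A <= #|TT|)%N.
  by apply/subset_leq_card/subsetP=> T; rewrite !inE => /andP[].
have sum_ge : (2 ^ (k * n) * #|TT| <= 16 * \sum_A g A)%N.
  have -> : (\sum_A g A = \sum_(T in TT) #|[set A | `[< halves_separate A T >]]|)%N.
    have gE A : g A = \sum_(T : {set 'I_n} | (#|T| == k) && `[< halves_separate A T >]) 1%N.
      by rewrite sum1dep_card.
    have hE T : #|[set A | `[< halves_separate A T >]]| =
        \sum_(A : 'M['F_2]_(k, n) | `[< halves_separate A T >]) 1%N.
      by rewrite sum1dep_card.
    rewrite (eq_bigr _ (fun A _ => gE A)) [RHS](eq_bigr _ (fun T _ => hE T)).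
    rewrite (exchange_big_dep (mem TT)) /=; last by move=> A T _ /andP[]; rewrite inE.
    apply: eq_bigr => T; rewrite inE => cT; apply: eq_bigl => A; first by rewrite cT.
  rewrite big_distrr /= mulnC -sum_nat_const; apply: leq_sum => T; rewrite inE => /eqP cT.
  exact: card_halves_separate.
have sum_le : (32 * \sum_A g A <= 32 * N * #|TT| + 2 ^ (k * n) * #|TT|)%N.
  rewrite (bigID (fun A => #|TT| <= 32 * g A)%N) /= mulnDr leq_add //.
    rewrite -mulnA leq_mul2l /= /N -sum_nat_cond_const.
    by rewrite leq_sum // => A _.
  rewrite big_distrr /= -cM -sum_nat_const [X in (X <= _)%N]big_mkcond /=.
  by apply: leq_sum => A _; case: (leqP #|TT| (32 * g A)) => //= lt_g; apply: ltnW.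
rewrite -(leq_pmul2r TT_gt0); move: sum_ge sum_le; move: (2 ^ _)%N (\sum_A _)%N => a b.
by move: #|TT| N => c d; clear; nia.
Qed.

End Halves.

(** * Existence of multilinear formulas *)

Section Existence.
Variables (K : comNzRingType) (n : nat).
Implicit Types (p q : mpoly n K) (a b : 'I_n -> nat).

Lemma degs_leS a b p : (forall i, a i <= b i)%N -> degs_le a p -> degs_le b p.
Proof. by move=> le_ab dp m pm i; apply: leq_trans (dp m pm i) (le_ab i). Qed.

Lemma degs_leC a (c : K) : degs_le a (mpolyC n c).
Proof. by move=> m; rewrite msuppC; case: eqP => // _; rewrite inE => /eqP -> i; rewrite mnm0E. Qed.

Lemma degs_leX a (m : multinom n) : (forall i, m i <= a i)%N -> degs_le a (mpolyX K m).
Proof. by move=> le_m m'; rewrite msuppX inE => /eqP ->. Qed.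

Lemma degs_leD a p q : degs_le a p -> degs_le a q -> degs_le a (p + q).
Proof.
by move=> dp dq m /msuppD_le; rewrite mem_cat => /orP[/dp|/dq].
Qed.

Lemma degs_leN a p : degs_le a p -> degs_le a (- p).
Proof. by move=> dp m; rewrite (perm_mem (msuppN p)) => /dp. Qed.

Lemma degs_leM a b p q : degs_le a p -> degs_le b q ->
  degs_le (fun i => a i + b i)%N (p * q).
Proof.
move=> dp dq m /msuppM_le /allpairsP[[m1 m2] /= [pm1 qm2 ->]] i.
by rewrite mnmDE leq_add // ?dp ?dq.
Qed.

Definition has_formula p := exists2 F : formula K n,
  multilinear_formula F & formula_poly F = p.

Lemma has_formulaD p q : has_formula p -> has_formula q -> has_formula (p + q).
Proof.
have ml (F : formula K n) : multilinear_formula F -> degs_le (fun=> 1%N) (formula_poly F).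
  by case: F => [c|i|F G|F G] /andP[/multilinearP].
move=> [F mlF <-] [G mlG <-]; exists (FAdd F G) => //=.
by rewrite mlF mlG !andbT; apply/multilinearP/degs_leD; apply: ml.
Qed.

Lemma has_formulaM p q : multilinear (p * q) ->
  has_formula p -> has_formula q -> has_formula (p * q).
Proof.
by move=> mlpq [F mlF Fp] [G mlG Gq]; exists (FMul F G); rewrite /= Fp Gq ?mlpq ?mlF ?mlG.
Qed.

Lemma has_formulaC (c : K) : has_formula (mpolyC n c).
Proof.
by exists (FConst n c) => //=; rewrite andbT; apply/multilinearP/degs_leC.
Qed.

Lemma has_formula_var i : has_formula (mpolyX K (mnm1 i)).
Proof.
exists (FVar K i) => //=; rewrite andbT; apply/multilinearP/degs_leX => j.
by rewrite mnm1E leq_b1.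
Qed.

Lemma has_formula_monomial (m : multinom n) (c : K) : (forall i, m i <= 1)%N ->
  has_formula (c *: mpolyX K m).
Proof.
move=> m_le1; rewrite -mul_mpolyC mpolyXE_id.
(* The degree bound records which variables have been multiplied in, so each partial product is seen
   to be multilinear. *)
suff [h d] : has_formula (\prod_i mpolyX K (mnm1 i) ^+ m i) /\
    degs_le (fun i => i \in index_enum 'I_n : nat) (\prod_i mpolyX K (mnm1 i) ^+ m i).
  apply: has_formulaM => //; last exact: has_formulaC.
  apply/multilinearP/(degs_leS _ (degs_leM (@degs_leC (fun=> 0%N) c) d)) => i.
  by rewrite add0n leq_b1.
elim: (index_enum 'I_n) (index_enum_uniq 'I_n) => [_|i r IH /= /andP[ri ur]].
  by rewrite big_nil; split; [exact: has_formulaC | exact: degs_leC].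
have [h d] := IH ur; rewrite big_cons.
have [hi di] : has_formula (mpolyX K (mnm1 i) ^+ m i) /\
    degs_le (fun j => i == j : nat) (mpolyX K (mnm1 i) ^+ m i).
  case: (m i) (m_le1 i) => [|[|//]] _.
    by rewrite expr0; split; [exact: has_formulaC | exact: degs_leC].
  rewrite expr1; split; first exact: has_formula_var.
  by apply: degs_leX => j; rewrite mnm1E.
have dM : degs_le (fun j => j \in i :: r : nat)
    (mpolyX K (mnm1 i) ^+ m i * \prod_(j <- r) mpolyX K (mnm1 j) ^+ m j).
  apply: degs_leS (degs_leM di d) => j; rewrite inE eq_sym.
  by case: eqVneq => // ->; rewrite (negPf ri).
split=> //; apply: has_formulaM => //; apply/multilinearP.
by apply: degs_leS dM => j; apply: leq_b1.
Qed.

(** With [multilinear_interpolation], this shows that the sets minimized in [MFS] and [MFS_approx]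
    are nonempty, so the default value 0 of [min_nat] does not intervene. *)
Lemma multilinear_has_formula p : multilinear p -> has_formula p.
Proof.
move=> /multilinearP; rewrite /degs_le => dp; rewrite [p]mpolyE.
elim: (msupp p) dp => [|m s IH] dp; first by rewrite big_nil; apply: has_formulaC.
rewrite big_cons; apply: has_formulaD.
  by apply: has_formula_monomial; apply: dp; rewrite inE eqxx.
by apply: IH => m' sm'; apply: dp; rewrite inE sm' orbT.
Qed.

Lemma multilinear_interpolation (f : cube n -> K) : exists2 p : mpoly n K,
  multilinear p & forall x, cube_eval p x = f x.
Proof.
(* The product of the literals of [x] is 1 at [x] and 0 at every other point of the cube. *)
pose lit (x : cube n) i : mpoly n K :=
  if x i then mpolyX K (mnm1 i) else 1 - mpolyX K (mnm1 i).
exists (\sum_x mpolyC n (f x) * \prod_i lit x i).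
  apply/multilinearP; elim/big_ind: _ => [|p q|x _]; first exact: degs_leC.
    exact: degs_leD.
  apply: (@degs_leS (fun i => 0 + (i \in index_enum 'I_n))%N) => [i|]; first exact: leq_b1.
  apply: degs_leM; first exact: degs_leC.
  elim: (index_enum 'I_n) (index_enum_uniq 'I_n) => [_|i r IH /= /andP[ri ur]].
    by rewrite big_nil; apply: degs_leC.
  rewrite big_cons; apply: (@degs_leS (fun j => (i == j) + (j \in r))%N) => [j|].
    by rewrite inE eq_sym; case: eqVneq => // ->; rewrite (negPf ri).
  apply: degs_leM (IH ur); have dX : degs_le (fun j => i == j : nat) (mpolyX K (mnm1 i)).
    by apply: degs_leX => j; rewrite mnm1E.
  rewrite /lit; case: ifP => // _; apply: degs_leD; first exact: degs_leC.
  exact: degs_leN.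
move=> y; rewrite /cube_eval raddf_sum (bigD1 y) //= [X in _ + X]big1 ?addr0 => [|x xy].
  rewrite mevalM mevalC  rmorph_prod big1 ?mulr1 // => i _.
  by rewrite /lit; case: ifP => yi /=; rewrite ?mevalB ?meval1 mevalXU yi ?subr0.
have [i xyi] : exists i, x i != y i.
  apply/existsP; apply: contraNT xy; rewrite negb_exists => /forallP xy.
  by apply/eqP/ffunP=> i; apply/eqP; have := xy i; rewrite negbK.
rewrite mevalM rmorph_prod (bigD1 i) //= mulrCA [X in X * _](_ : _ = 0) ?mul0r //.
rewrite /lit; move: xyi; case: (x i); case yi: (y i) => //= _.
  by rewrite mevalXU yi.
by rewrite mevalB meval1 mevalXU yi subrr.
Qed.
End Existence.

(** * The lower bound *)

Local Open Scope complex_scope.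

Definition often_separating k n : {set 'M['F_2]_(k, n)} :=
  [set A : 'M['F_2]_(k, n) |
     #|[set T : {set 'I_n} | #|T| == k]| <=
     32 * #|[set T : {set 'I_n} | (#|T| == k) && `[< halves_separate A T >]]| ]%N.

(* All but few of the partitions unbalance some block of every term of the
   decomposition, so each term, hence the polynomial, has low rank. *)
Lemma exists_low_rank_half (K : idomainType) (k n b w : nat) (F : formula K n)
    (A : 'M['F_2]_(k, n)) : n = (k + k)%N ->
  multilinear_formula F -> A \in often_separating k n ->
  (2 ^ (16 * b) <= n)%N -> (w.+1 <= 2 ^ (3 * b))%N ->
  (formula_size F * (32 * n.+1) < 2 ^ (4 * b * b))%N ->
  exists T : {set 'I_n}, [/\ halves_separate A T &
    separable T (formula_size F * 2 ^ (k - w)) (cube_eval (formula_poly F))].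
Proof.
move=> nE mlF oA len lew lts; set s := formula_size F in lts *.
(* These values give [L * 4 ^ t] = 2^(16b) <= n, while [t] blocks leave a term with a fraction of at
   most 2^(-4b^2) of bad sets. *)
set p := cube_eval _; pose L := (2 ^ (8 * b))%N; pose t := (4 * b)%N.
have L_gt0 : (0 < L)%N by rewrite expn_gt0.
have := multilinear_formula_decomposable L_gt0 mlF.
case/(_ t setT setT (subxx _)); rewrite ?cardsT ?card_ord.
- by rewrite leq_pmull.
- by apply: leq_trans len; rewrite /L /t -(expnM 2 2) -expnD leq_exp2l //; lia.
move=> I [G [cI pE _ bG]].
have [Bad BadP] : exists Bad : I -> {set {set 'I_n}}, forall i,
    (#|Bad i| * 2 ^ (b * t) <= 2 ^ n)%N /\
    forall T : {set 'I_n}, #|T| = k -> #|~: T| = k -> T \notin Bad i ->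
      separable T (2 ^ (k - w)) (G i).
  apply: (fin_all_exists (U := fun=> {set {set 'I_n}})
    (P := fun i U => (#|U| * 2 ^ (b * t) <= 2 ^ n)%N /\ forall T : {set 'I_n},
       #|T| = k -> #|~: T| = k -> T \notin U -> separable T (2 ^ (k - w)) (G i))) => i.
  have [Bs [szBs blBs spBs]] := bG i.
  exists [set T : {set 'I_n} | (T \subset setT) && all (balanced w T) Bs]; split.
    rewrite -szBs -[X in (_ <= 2 ^ X)%N](card_ord n) -cardsT.
    exact: card_all_balanced blBs _ _.
  move=> T cT cT'; rewrite inE subsetT /= => /allPn[B BsB nbal].
  apply: splits_separable cT cT' nbal.
  have [f [f' [fB f'B E]]] := spBs (fun=> 1) B (fun _ _ _ => erefl) BsB.
  by exists f, f'; split=> // x; rewrite -E mul1r.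
pose Sep := [set T : {set 'I_n} | (#|T| == k) && `[< halves_separate A T >]].
(* Sets of size [k] are at least a 1/(n+1) fraction of all subsets, and at least 1/32 of them
   separate. *)
have cSep : (2 ^ n <= 32 * n.+1 * #|Sep|)%N.
  have := oA; rewrite inE -/Sep card_draws card_ord => leC.
  apply: leq_trans (central_bin_ge n) _; rewrite [(32 * _)%N]mulnC -mulnA leq_mul2l.
  by rewrite (_ : n./2 = k) // nE addnn doubleK.
have cBad : (#|\bigcup_i Bad i| * 2 ^ (b * t) <= s * 2 ^ n)%N.
  apply: (@leq_trans ((\sum_i #|Bad i|) * 2 ^ (b * t))).
    rewrite leq_mul2r; apply/orP; right.
    elim/big_rec2: _ => [|i U m _ leU]; first by rewrite cards0.
    by apply: leq_trans (leq_card_setU _ _) _; rewrite leq_add2l.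
  rewrite big_distrl /=; apply: (@leq_trans (\sum_(i : I) 2 ^ n)).
    by apply: leq_sum => i _; have [] := BadP i.
  by rewrite sum_nat_const leq_mul2r cI orbT.
(* Union bound: the bad sets of all terms together are too few to cover the separating ones. *)
have : ~~ (Sep \subset \bigcup_i Bad i).
  apply/negP=> /subset_leq_card leSep.
  suff : (2 ^ n * 2 ^ (b * t) <= s * (32 * n.+1) * 2 ^ n)%N.
    rewrite mulnC leq_pmul2r ?expn_gt0 // leqNgt; move/negP; apply.
    by rewrite (_ : (b * t = 4 * b * b)%N) // /t mulnC.
  apply: leq_trans (leq_mul cSep (leqnn _)) _.
  set M := (32 * n.+1)%N; rewrite -mulnA [(s * M)%N]mulnC -mulnA leq_mul2l; apply/orP; right.
  by apply: leq_trans cBad; rewrite leq_mul2r leSep orbT.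
case/subsetPn=> T; rewrite inE => /andP[/eqP cT /asboolP sepT] nbad.
have cT' : #|~: T| = k by apply: (@addnI k); rewrite -{1}cT cardsC card_ord.
exists T; split=> //.
have sepG i : separable T (2 ^ (k - w)) (G i).
  have [_ sepi] := BadP i; apply: sepi => //.
  by apply: contra nbad => bT; apply/bigcupP; exists i.
have [J [u [v [cJ uT vT E]]]] := separable_sum (index_enum I) sepG.
exists J, u, v; split=> // [|x].
  by apply: leq_trans cJ _; rewrite leq_mul2r -sum1_size sum1_card cI orbT.
rewrite -E -pE; congr p; apply/ffunP=> i; by rewrite ffunE inE.
Qed.

(** The matrix bound with c^2 = 1/#|S| reads (#|S| - r)/#|S| <= eps, and #|S| is at least 2^k. *)
Lemma rank_indicator_bound (R : realType) (eps : R) (k n r : nat)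
    (A : 'M['F_2]_(k, n)) (T : {set 'I_n}) (p : mpoly n R[i]) : n = (k + k)%N ->
  halves_separate A T -> separable T r (cube_eval p) -> 0 <= eps -> eps < 1 ->
  approximates eps (fun x => (normalized_indicator R (kernel_set A) x)%:C) p ->
  (1 - eps) * 2 ^+ k <= r%:R.
Proof.
move=> nE [injT injC] sep eps0 eps1; set S := kernel_set A in injT injC *.
have S_ge : (2 ^ k <= #|S|)%N by apply: card_kernel_set.
have S_gt0 : 0 < #|S|%:R :> R by rewrite ltr0n (leq_trans _ S_ge) ?expn_gt0.
pose c : R := 1 / Num.sqrt #|S|%:R.
have c_ge0 : 0 <= c by rewrite divr_ge0 ?sqrtr_ge0.
have cE : c ^+ 2 = #|S|%:R^-1.
  by rewrite /c expr_div_n expr1n sqr_sqrtr ?div1r // ltW.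
rewrite /approximates => ap.
have := separable_approx_indicator (c := c%:C) (e := eps%:C) injT injC sep.
have -> : \sum_x `|cube_eval p x - c%:C *+ (x \in S)| ^+ 2 =
    \sum_x `|cube_eval p x - (normalized_indicator R S x)%:C| ^+ 2.
  apply: eq_bigr => x _; rewrite /normalized_indicator -/S -/c.
  by case: (x \in S).
move=> /(_ ap); rewrite ger0_norm ?ler0c // -rmorphXn -[_%:R](rmorph_nat (real_complex R)).
rewrite -rmorphM lecR cE ler_pdivrMr // => leE.
have le_r : (1 - eps) * #|S|%:R <= r%:R.
  (* The subtraction [#|S| - r] is truncated, so [r] at least #|S| is treated apart. *)
  have [leSr|/ltnW ltrS] := leqP #|S| r.
    by apply: (@le_trans _ _ #|S|%:R); rewrite ?ler_nat // ler_piMl ?(ltW S_gt0) // gerBl.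
  by move: leE; rewrite natrB // mulrBl mul1r lerBlDr addrC -lerBlDr.
apply: le_trans le_r; rewrite ler_wpM2l ?subr_ge0 ?(ltW eps1) //.
by rewrite -natrX ler_nat.
Qed.

Lemma MFS_attained (K : comNzRingType) n (p : mpoly n K) : multilinear p ->
  exists F : formula K n,
    [/\ multilinear_formula F, formula_poly F = p & formula_size F = MFS p].
Proof.
move=> mlp; rewrite /MFS; set P := (X in min_nat X).
have [] // := @min_natP P.
by have [F mlF Fp] := multilinear_has_formula mlp; exists (formula_size F), F.
Qed.

Lemma MFS_approx_attained (R : realType) n (eps : R) (f : cube n -> R[i]) : 0 <= eps ->
  exists F : formula R[i] n, [/\ multilinear_formula F,
    approximates eps f (formula_poly F) & formula_size F = MFS_approx eps f].
Proof.
move=> eps0; have [p [mlp ap <-]] : exists p : mpoly n R[i],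
    [/\ multilinear p, approximates eps f p & MFS p = MFS_approx eps f].
  rewrite /MFS_approx; set P := (X in min_nat X).
  have [] // := @min_natP P.
  have [p mlp pf] := multilinear_interpolation f; exists (MFS p), p; split=> //.
  rewrite /approximates big1 ?ler0c // => x _.
  by rewrite pf subrr normr0 expr0n.
by have [F [mlF Fp sF]] := MFS_attained mlp; exists F; rewrite Fp.
Qed.

(** With imbalance w = 2b^2, a formula smaller than 2^(b^2) would have rank below 2^(k - b^2) for a
    separating partition, forcing (1 - eps) 2^(b^2) < 1 against the choice of [b]. The union bound
    needs b^2 + 5 + 16(b+1) < 4b^2, which [8 <= b] ensures. *)
Lemma MFS_approx_ge (R : realType) (eps : R) (k n b : nat) (A : 'M['F_2]_(k, n)) :
  n = (k + k)%N -> 0 <= eps -> eps < 1 -> (8 <= b)%N -> 1 < (1 - eps) * 2 ^+ b ->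
  (2 ^ (16 * b) <= n)%N -> (n < 2 ^ (16 * b.+1))%N -> A \in often_separating k n ->
  (2 ^ (b * b) <= MFS_approx eps (fun x => (normalized_indicator R (kernel_set A) x)%:C))%N.
Proof.
move=> nE eps0 eps1 b_ge8 epsb len ltn oA.
have [F [mlF apF <-]] := MFS_approx_attained
  (fun x => (normalized_indicator R (kernel_set A) x)%:C) eps0.
rewrite leqNgt; apply/negP=> lts; pose w := (2 * b * b)%N.
have le_b_pow : (b <= 2 ^ b)%N by apply/ltnW/ltn_expl.
have le_w : (w.+1 <= 2 ^ (3 * b))%N.
  rewrite (_ : 3 * b = b + b + b)%N; last by lia.
  rewrite !expnD /w; have : (8 <= 2 ^ b)%N by apply: leq_trans b_ge8 _.
  move: le_b_pow; move: (2 ^ b)%N => q; nia.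
have le_wk : (w <= k)%N.
  have : (2 ^ (3 * b) * 2 <= n)%N.
    by apply: leq_trans len; rewrite -expnSr leq_exp2l //; lia.
  by rewrite nE; lia.
have [] := exists_low_rank_half nE mlF oA len le_w.
  have lt_n : (n.+1 <= 2 ^ (16 * b.+1))%N by [].
  apply: (@leq_ltn_trans (2 ^ (b * b) * (32 * 2 ^ (16 * b.+1)))%N).
    by rewrite leq_mul ?leq_mul // ltnW.
  rewrite -(expnD 2 5) -expnD ltn_exp2l //.
  by move: b_ge8; clear; nia.
move=> T [sepT sepp]; have := rank_indicator_bound nE sepT sepp eps0 eps1 apF.
rewrite natrM natrX -{1}(subnK le_wk) exprD mulrA [X in X <= _]mulrAC.
rewrite ler_pM2r ?exprn_gt0 // => leps.
have : (1 - eps) * 2 ^+ w < 2 ^+ (b * b).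
  by apply: le_lt_trans leps _; rewrite -natrX ltr_nat.
rewrite (_ : w = b * b + b * b)%N; last by rewrite /w -mulnA mul2n addnn.
rewrite exprD mulrA gtr_pMl ?exprn_gt0 // => /lt_trans/(_ epsb).
rewrite ltr_pM2l ?subr_gt0 // ltNge ler_weXn2l ?ler1n //.
by rewrite leq_pmulr // (leq_trans _ b_ge8).
Qed.

(** Here n <= 2^(32b), so (ln n)^2 <= 1024 b^2 (ln 2)^2, and ln 2 <= 1 turns the square of ln 2 into
    the single factor needed in base 2. *)
Lemma powR_log_le (R : realType) n b : (0 < n)%N -> (0 < b)%N ->
  (n < 2 ^ (16 * b.+1))%N ->
  n%:R `^ (1 / 1024 * ln n%:R) <= 2 ^+ (b * b) :> R.
Proof.
move=> n_gt0 b_gt0 ltn.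
have ln2_le1 : ln 2 <= 1 :> R.
  by have := @le_ln1Dx R 1; apply; apply: gtrN.
have ln2_ge0 : 0 <= ln 2 :> R by rewrite ln_ge0 // ler1n.
have lnn_ge0 : 0 <= ln n%:R :> R by rewrite ln_ge0 // ler1n.
have lnn : ln n%:R <= (32 * b)%:R * ln 2 :> R.
  rewrite mulr_natl -lnXn // ler_ln ?posrE ?ltr0n ?exprn_gt0 //.
  rewrite -natrX ler_nat; apply/ltnW/(leq_trans ltn).
  by rewrite leq_exp2l //; lia.
rewrite /powR pnatr_eq0 (gtn_eqF n_gt0) -[X in _ <= X]lnK ?posrE ?exprn_gt0 // ler_expR.
rewrite lnXn // -[X in _ <= X]mulr_natl natrM.
apply: (@le_trans _ _ (1 / 1024 * ((32 * b)%:R * ln 2) * ((32 * b)%:R * ln 2))).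
  have c_gt0 : 0 < 1 / 1024 :> R by rewrite divr_gt0.
  by apply: ler_pM; rewrite ?ler_pM2l // mulr_ge0 // ltW.
rewrite natrM; set B := b%:R; set l := ln 2 in ln2_le1 ln2_ge0 *.
have -> : 1 / 1024 * (32 * B * l) * (32 * B * l) = B * B * l * l by field.
by rewrite ler_piMr // !mulr_ge0.
Qed.

Lemma random_matrix_prob_ge (R : realType) m n (E : pred 'M['F_2]_(m, n))
    (S : {set 'M['F_2]_(m, n)}) (d : nat) : {subset S <= E} ->
  (2 ^ (m * n) <= d * #|S|)%N -> d%:R^-1 <= random_matrix_prob R E.
Proof.
move=> sSE leS; have d_gt0 : (0 < d)%N.
  by move: leS; case: d => //; rewrite mul0n leqNgt expn_gt0.
rewrite /random_matrix_prob.
rewrite (eq_bigr (fun=> (1 / 2 : R) ^+ (m * n))) => [|A _]; last first.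
  by rewrite !prodr_const !card_ord -exprM mulnC.
apply: (@le_trans _ _ (\sum_(A in S) (1 / 2 : R) ^+ (m * n))).
  rewrite sumr_const -[X in _ <= X]mulr_natr div1r exprVn ler_pdivlMl ?exprn_gt0 //.
  by rewrite ler_pdivrMr ?ltr0n // -natrX -natrM ler_nat [(_ * d)%N]mulnC.
rewrite [X in _ <= X](bigID (mem S)) /= -[X in X <= _]addr0 lerD //.
  rewrite [X in _ <= X](eq_bigl (mem S)) // => A.
  rewrite andbC /=; case: (boolP (A \in S)) => //= SA.
  by rewrite [E A](sSE _ SA).
by apply: sumr_ge0 => A _; apply: exprn_ge0; rewrite divr_ge0.
Qed.

Theorem theorem15 (R : realType) (eps : R) (eps_ge0 : 0 <= eps)
    (eps_lt1 : eps < 1) :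
  exists c c' : R, [/\ 0 < c, 0 < c' &
    exists n0 : nat, forall n : nat, (n0 <= n)%N -> ~~ odd n ->
      c' <= random_matrix_prob R (fun A : 'M['F_2]_(n./2, n) =>
        n%:R `^ (c * ln n%:R) <=
        (MFS_approx eps
          (fun x => (normalized_indicator R (kernel_set A) x)%:C))%:R)].
Proof.
exists (1 / 1024), 32%:R^-1; split; rewrite ?divr_gt0 ?invr_gt0 //.
(* The Archimedean bound makes 2^b exceed 1/(1 - eps) once [b0 <= b]; the 8 is the slack required by
   [MFS_approx_ge]. *)
pose b0 := maxn 8 (Num.Def.archi_bound (1 - eps)^-1).
exists (2 ^ (16 * b0))%N => n len ev_n.
have n_gt0 : (0 < n)%N by apply: leq_trans len; rewrite expn_gt0.
have nE : n = (n./2 + n./2)%N by rewrite addnn even_halfK.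
(* The largest [b] with 2^(16b) <= n. *)
pose b := (trunc_log 2 n %/ 16)%N.
have le_b0b : (b0 <= b)%N.
  by rewrite leq_divRL // mulnC trunc_log_max.
have ge_n : (2 ^ (16 * b) <= n)%N.
  apply: leq_trans (trunc_logP (isT : 1 < 2)%N n_gt0).
  by rewrite leq_exp2l // mulnC leq_trunc_div.
have lt_n : (n < 2 ^ (16 * b.+1))%N.
  apply: (leq_trans (trunc_log_ltn n (isT : 1 < 2)%N)).
  by rewrite leq_exp2l // mulnC ltn_ceil.
have b_ge8 : (8 <= b)%N by apply: leq_trans le_b0b; apply: leq_maxl.
have epsb : 1 < (1 - eps) * 2 ^+ b.
  rewrite mulrC -ltr_pdivrMr ?subr_gt0 // div1r upper_nthrootP //.
  by apply: leq_trans le_b0b; apply: leq_maxr.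
apply: (@random_matrix_prob_ge _ _ _ _ (often_separating n./2 n)); last first.
  by apply: card_often_separating; rewrite // half_gt0; lia.
move=> A oA; apply: le_trans (powR_log_le R n_gt0 _ lt_n) _; first by lia.
by rewrite -natrX ler_nat; apply: (MFS_approx_ge nE).
Qed.
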